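(* Let $\mathcal{G}=(A\dot\cup B,E)$ be a $k$-regular measure-preserving graph in a first-order structure $\mathcal{S}$ (with respect to a fixed collection of isomorphisms $\mathcal{I}_n$), where $k\geq 2$. Then for every positive integer $m$ there is a definable matching $M\subseteq E$ covering the vertex set outside of a (definable) subset $Y_0$ satisfying $Y_0\leq_m A\dot\cup B$.
   Context: ''Definable'' means definable in $\mathcal{S}=(S;\dots)$ with parameters. A set of isomorphisms $\mathcal{I}_n$ is a specified collection of definable bijections $S^n\to S^n$ closed under composition and inverses. A definable bipartite graph with bipartition $A,B\subseteq S^n$ and edges $E\subseteq A\times B$ (viewed symmetrically) is measure-preserving if there are definable pairwise disjoint $A_1,\dots,A_l\subseteq A$ such that $E\cap(A_i\times S^n)=\dot\bigcup_{f\in\mathcal{F}_i}\Gamma f$ with $\mathcal{F}_i$ a finite set of definable bijections $f\colon A_i\to B$, each of which is the restriction to $A_i$ of some isomorphism in $\mathcal{I}_n$. $k$-regular means every vertex is incident with exactly $k$ edges. A matching is a set of edges no two sharing a vertex; it covers the vertices incident with its edges. For definable $X,Y$: $X\leq Y$ means there is a finite definable partition $\{X_i\}$ of $X$ and isomorphisms $f_i$ with the $f_i(X_i)$ pairwise disjoint and contained in $Y$; $nX$ is the disjoint union of $n$ copies of $X$; for $m>0$, $X\leq_m Y$ means there are positive integers $p,q$ with $m\leq p/q$ and $pX\leq qY$.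
   Formalization: In the definition of measure-preserving, the sets A_1,…,A_l are additionally required to cover A; without this, l = 0 would make every definable bipartite graph measure-preserving and the claim false. *)

(* Defs.v *)
From mathcomp Require Import all_boot all_order all_algebra.
From mathcomp Require Import boolp classical_sets functions cardinality.

Set Implicit Arguments.
Unset Strict Implicit.
Unset Printing Implicit Defensive.

Local Open Scope classical_set_scope.
Local Open Scope card_scope.

(** * First-order structures and definability with parameters *)

Record fo_language := FoLanguage {
  fsym : Type;
  far : fsym -> nat;
  rsym : Type;
  rar : rsym -> nat }.

Record fo_structure (L : fo_language) := FoStructure {
  carrier :> Type;
  finterp : forall f : fsym L, ('I_(far f) -> carrier) -> carrier;
  rinterp : forall r : rsym L, ('I_(rar r) -> carrier) -> Prop }.

(* Terms and formulas with free variables in V; the constants [Par s] name the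
   elements of the structure, so that definability is with parameters.  The
   variable bound by [Ex] is [None : option V]. *)
Inductive term (L : fo_language) (S : fo_structure L) (V : Type) : Type :=
| Var of V
| Par of S
| App (f : fsym L) of ('I_(far f) -> term S V).

Inductive formula (L : fo_language) (S : fo_structure L) (V : Type) : Type :=
| Eq of term S V & term S V
| Rel (r : rsym L) of ('I_(rar r) -> term S V)
| Not of formula S V
| And of formula S V & formula S V
| Ex of formula S (option V).

Fixpoint eval L (S : fo_structure L) V (e : V -> S) (t : term S V) : S :=
  match t with
  | Var v => e v
  | Par s => s
  | App f ts => finterp (fun i => eval e (ts i))
  end.

Fixpoint holds L (S : fo_structure L) V (e : V -> S) (phi : formula S V) :
    Prop :=
  match phi with
  | Eq t u => eval e t = eval e u
  | Rel r ts => rinterp (fun i => eval e (ts i))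
  | Not psi => ~ holds e psi
  | And psi chi => holds e psi /\ holds e chi
  | Ex psi => exists a : S, holds (oapp e a) psi
  end.

Definition pt L (S : fo_structure L) (n : nat) := 'I_n -> S.

Definition definable L (S : fo_structure L) n (X : set (pt S n)) :=
  exists phi : formula S 'I_n, X = [set x | holds x phi].

(* Subsets of S^n x S^n, identified with S^(n+n). *)
Definition definable_rel L (S : fo_structure L) n
    (E : set (pt S n * pt S n)) :=
  exists phi : formula S ('I_n + 'I_n)%type,
    E = [set z | holds (fun v => match v with
                                 | inl i => z.1 i
                                 | inr j => z.2 j
                                 end) phi].

(* The graph of the restriction of f to A. *)
Definition graph_on (T U : Type) (A : set T) (f : T -> U) : set (T * U) :=
  [set z | A z.1 /\ z.2 = f z.1].

Definition isomorphism_set L (S : fo_structure L) n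
    (I : set (pt S n -> pt S n)) :=
  [/\ forall f, I f -> bijective f /\ definable_rel (graph_on setT f),
      forall f g, I f -> I g -> I (g \o f)
    & forall f g, I f -> cancel f g -> cancel g f -> I g].

(** * Bipartite graphs *)

Definition definable_bipartite_graph L (S : fo_structure L) n
    (A B : set (pt S n)) (E : set (pt S n * pt S n)) :=
  [/\ definable A, definable B, definable_rel E,
      A `&` B = set0 & E `<=` A `*` B].

(* A map f : P i -> B is represented by a total function of which only the
   restriction to P i matters; it is a bijection onto its image in B.  The
   sets P i are required to cover A: otherwise l = 0 would make every definable
   bipartite graph measure-preserving. *)
Definition measure_preserving L (S : fo_structure L) n
    (I : set (pt S n -> pt S n)) (A B : set (pt S n))
    (E : set (pt S n * pt S n)) :=
  definable_bipartite_graph A B E /\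
  exists (l : nat) (P : 'I_l -> set (pt S n))
         (F : 'I_l -> set (pt S n -> pt S n)),
    [/\ forall i, definable (P i),
        trivIset setT P,
        \bigcup_i P i = A
      & forall i,
        [/\ finite_set (F i),
            forall f, F i f ->
              [/\ definable_rel (graph_on (P i) f),
                  set_fun (P i) B f,
                  set_inj (P i) f
                & exists2 g, I g & forall x, P i x -> f x = g x],
            trivIset (F i) (graph_on (P i))
          & E `&` (P i `*` setT) = \bigcup_(f in F i) graph_on (P i) f]].

Definition incident (T : Type) (e : T * T) (v : T) := e.1 = v \/ e.2 = v.

Definition k_regular (T : Type) (k : nat) (A B : set T) (E : set (T * T)) :=
  forall v, (A `|` B) v -> [set e | E e /\ incident e v] #= `I_k.

Definition matching (T : Type) (E M : set (T * T)) :=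
  M `<=` E /\
  forall e e' v, M e -> M e' -> incident e v -> incident e' v -> e = e'.

Definition covered (T : Type) (M : set (T * T)) : set T :=
  [set v | exists2 e, M e & incident e v].

(** * Comparison of definable sets *)

Definition copies (T : Type) (p : nat) (X : set T) : set ('I_p * T) :=
  [set z | X z.2].
Arguments copies {T} p X.

(* X <= Y for disjoint unions of copies of definable sets (plain definable sets
   being the case p = q = 1): the j-th piece is Q j inside the copy c j, and
   f j moves it into the copy d j.  Pieces may be empty. *)
Definition copies_le L (S : fo_structure L) n (I : set (pt S n -> pt S n))
    (p q : nat) (X : set ('I_p * pt S n)) (Y : set ('I_q * pt S n)) :=
  exists (r : nat) (Q : 'I_r -> set (pt S n)) (c : 'I_r -> 'I_p)
         (d : 'I_r -> 'I_q) (f : 'I_r -> pt S n -> pt S n),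
    [/\ forall j, definable (Q j) /\ I (f j),
        trivIset setT (fun j => [set c j] `*` Q j),
        \bigcup_j ([set c j] `*` Q j) = X,
        trivIset setT (fun j => [set d j] `*` (f j @` Q j))
      & forall j, [set d j] `*` (f j @` Q j) `<=` Y].

Definition le_m L (S : fo_structure L) n (I : set (pt S n -> pt S n))
    (m : rat) (X Y : set (pt S n)) :=
  exists p q : nat,
    [/\ (0 < p)%N, (0 < q)%N, (m <= p%:R / q%:R)%R
      & copies_le I (copies p X) (copies q Y)].

(* Main.v *)
(** The edges of a measure-preserving graph are coloured by finitely many partial
    isomorphisms, so that any choice between the edges at a vertex can be made
    definably.  Run an auction: each unmatched [x] in [A] that has a neighbour
    of price below [D] bids for its cheapest neighbour; an object receiving bids
    accepts one of them, drops its former holder, and becomes dearer by one.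

    After [s] rounds the vertices still bidding amount to at most [|J| D / s] of
    [B], [J] being the set of colours: the bidders never gain in size, and a bid is
    charged to an increase of a price.  A matched vertex pays at most one more
    than the price of any neighbour, and an unmatched vertex that no longer bids
    has only neighbours of price at least [D].  Summing the prices over all edges
    from both sides, [k] times the total price cancels, and the vertices of the
    latter kind amount to about [1/D] of [B].  Unmatched vertices of [B] are
    compared with those of [A] by counting edges.

    In the preorder of piecewise isomorphism of finite formal sums of definable
    sets, cancellation only holds approximately: [phi + chi <= psi + chi] gives
    [c phi <= c psi + chi] for every [c]. *)

Require Import Defs.
From mathcomp Require Import all_boot all_order all_algebra.
From mathcomp Require Import boolp classical_sets functions cardinality.
From mathcomp Require Import zify.

Set Implicit Arguments.
Unset Strict Implicit.
Unset Printing Implicit Defensive.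

Local Open Scope classical_set_scope.

(** * Closure properties of definability *)

Section Formulas.
Context (L : fo_language) (S : fo_structure L).

Fixpoint rename_term V W (s : V -> W) (t : term S V) : term S W :=
  match t with
  | Var v => @Var L S W (s v)
  | Par a => @Par L S W a
  | App f ts => @App L S W f (fun i => rename_term s (ts i))
  end.

Fixpoint rename V W (s : V -> W) (phi : formula S V) : formula S W :=
  match phi with
  | Eq t u => Eq (rename_term s t) (rename_term s u)
  | Rel r ts => @Rel L S W r (fun i => rename_term s (ts i))
  | Not psi => Not (rename s psi)
  | And psi chi => And (rename s psi) (rename s chi)
  | Ex psi => Ex (rename (omap s) psi)
  end.

Lemma eval_rename V W (s : V -> W) (e : W -> S) (t : term S V) :
  eval e (rename_term s t) = eval (e \o s) t.
Proof.
elim: t => //= f ts IH; congr finterp.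
by apply: funext => i; exact: IH.
Qed.

Lemma holds_rename V W (s : V -> W) (e : W -> S) (phi : formula S V) :
  holds e (rename s phi) <-> holds (e \o s) phi.
Proof.
elim: phi W s e => {V} /= [V t u|V r ts|V psi IH|V psi IHp chi IHc|V psi IH] W s e.
- by rewrite !eval_rename.
- suff -> : (fun i => eval e (rename_term s (ts i))) =
    (fun i => eval (e \o s) (ts i)) by [].
  by apply: funext => i; rewrite eval_rename.
- by rewrite IH.
- by rewrite IHp IHc.
- have Ee a : oapp e a \o omap s = oapp (e \o s) a by apply: funext; case.
  by split=> -[a]; [rewrite IH Ee | rewrite -Ee -IH]; exists a.
Qed.

(** Definability over an arbitrary type of variables, so that points, pairs of points and the
    variable bound by a quantifier are treated alike. *)
Definition expressible V (P : (V -> S) -> Prop) :=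
  exists phi : formula S V, forall e, holds e phi <-> P e.

Lemma expressible_not V (P : (V -> S) -> Prop) :
  expressible P -> expressible (fun e => ~ P e).
Proof. by case=> phi phiP; exists (Not phi) => e /=; rewrite phiP. Qed.

Lemma expressible_and V (P Q : (V -> S) -> Prop) :
  expressible P -> expressible Q -> expressible (fun e => P e /\ Q e).
Proof.
by move=> [phi phiP] [psi psiP]; exists (And phi psi) => e /=; rewrite phiP psiP.
Qed.

Lemma expressible_iff V (P Q : (V -> S) -> Prop) :
  expressible P -> (forall e, P e <-> Q e) -> expressible Q.
Proof. by move=> [phi phiP] PQ; exists phi => e; rewrite phiP. Qed.

Lemma expressible_rename V W (s : V -> W) (P : (V -> S) -> Prop) :
  expressible P -> expressible (fun e => P (e \o s)).
Proof. by case=> phi phiP; exists (rename s phi) => e; rewrite holds_rename. Qed.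

(** As [V] and [S] may be empty, no term need exist outside a quantifier; falsity is therefore an
    existential formula conjoined with its negation. *)
Lemma expressible_False V : expressible (fun _ : V -> S => False).
Proof.
have [phi phiP] : expressible (fun e : V -> S => exists a : S, True).
  by exists (Ex (Eq (@Var L S _ None) (@Var L S _ None))) => e /=; split=> -[a]; exists a.
by exists (And phi (Not phi)) => e /=; tauto.
Qed.

Lemma expressible_or V (P Q : (V -> S) -> Prop) :
  expressible P -> expressible Q -> expressible (fun e => P e \/ Q e).
Proof.
move=> dP dQ; apply: (@expressible_iff _ (fun e => ~ (~ P e /\ ~ Q e))); last first.
  by move=> e; rewrite -not_orE notK.
by apply/expressible_not/expressible_and; exact: expressible_not.
Qed.

Lemma expressible_exists_fin V (J : finType) (P : J -> (V -> S) -> Prop) :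
  (forall j, expressible (P j)) -> expressible (fun e => exists j, P j e).
Proof.
move=> dP; suff dPs (s : seq J) : expressible (fun e => exists2 j, j \in s & P j e).
  apply: expressible_iff (dPs (enum J)) _ => e.
  by split=> -[j]; exists j; rewrite ?mem_enum.
elim: s => [|i s IH].
  by apply: expressible_iff (expressible_False V) _ => e; split=> // -[].
apply: expressible_iff (expressible_or (dP i) IH) _ => e; split.
- case=> [Pi|[j js Pj]]; first by exists i; rewrite ?mem_head.
  by exists j; rewrite // in_cons js orbT.
- case=> j; rewrite in_cons => /orP[/eqP ->|js Pj]; [by left | right].
  by exists j.
Qed.

Lemma expressible_exists_point m V (P : (V + 'I_m -> S) -> Prop) :
  expressible P ->
  expressible (fun e : V -> S => exists y : 'I_m -> S,
    P (fun v => match v with inl v => e v | inr i => y i end)).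
Proof.
elim: m V P => [|m IH] V P dP.
  pose s (v : V + 'I_0) : V :=
    match v with inl v => v | inr i => match notF (ltn_ord i) with end end.
  apply: expressible_iff (expressible_rename s dP) _ => e.
  have E y : e \o s = (fun v => match v with inl v => e v | inr i => y i end).
    by apply: funext => -[//|[]].
  by split=> [Pe|[y]]; [exists (fun i : 'I_0 => match notF (ltn_ord i) with end)|];
    rewrite -?E // (E y).
(* Coordinate [0] becomes the bound variable [None]; the others are shifted down and left to the
   induction hypothesis. *)
pose s (v : V + 'I_m.+1) : option V + 'I_m :=
  match v with
  | inl v => inl (Some v)
  | inr i => if unlift ord0 i is Some j then inr j else inl None
  end.
have [phi phiP] := IH _ _ (expressible_rename s dP).
exists (Ex phi) => e /=; split=> [[a /phiP[y]]|[y Py]].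
  set f := _ \o s => Pf.
  exists (fun i => if unlift ord0 i is Some j then y j else a).
  suff -> : (fun v => match v with inl v => e v
    | inr i => if unlift ord0 i is Some j then y j else a end) = f by [].
  by apply: funext => -[//|i] /=; rewrite /f /=; case: (unlift ord0 i).
exists (y ord0); apply/phiP; exists (fun j => y (lift ord0 j)).
set f := _ \o s.
suff -> : f = (fun v => match v with inl v => e v | inr i => y i end) by [].
by apply: funext => -[//|i]; rewrite /f /=; case: unliftP => [j ->|->].
Qed.

Lemma definable_expressible n (X : set (pt S n)) :
  definable X <-> expressible X.
Proof.
split=> -[phi]; first by move=> ->; exists phi.
by move=> phiP; exists phi; apply/predeqP => x; rewrite /= phiP.
Qed.

Lemma definable_relP n (E : set (pt S n * pt S n)) :
  definable_rel E <->
  expressible (fun e : 'I_n + 'I_n -> S => E (e \o inl, e \o inr)).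
Proof.
split=> -[phi phiP]; exists phi.
  move=> e; rewrite phiP /=.
  suff -> : (fun v => match v with inl i => (e \o inl) i | inr j => (e \o inr) j end)
    = e by [].
  by apply: funext => -[].
by apply/predeqP => -[x y]; rewrite /= phiP.
Qed.

(** Since [f] is given by its graph and not by terms, its value is quantified as a new point. *)
Lemma definable_preimage n (f : pt S n -> pt S n) (X : set (pt S n)) :
  definable_rel (graph_on setT f) -> definable X -> definable (f @^-1` X).
Proof.
move=> /definable_relP df /definable_expressible dX.
apply/definable_expressible.
have /expressible_exists_point := expressible_and df
  (expressible_rename (@inr 'I_n 'I_n) dX).
move=> dfX; apply: expressible_iff dfX _ => e; split=> /=.
- by case=> y [[_ /= yE]]; rewrite yE.
- by move=> Xe; exists (f e).
Qed.

End Formulas.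

(** * Simple definable functions *)

Section SimpleFunctions.
Context (L : fo_language) (S : fo_structure L) (n : nat).
Local Notation point := (pt S n).

(** A function constant on the parts of a finite definable partition labelled by [K]. As [U] and [d]
    are arbitrary, postcomposition with any function is free, so finite choices can be made
    pointwise. *)
Definition simple_definable U (phi : point -> U) :=
  exists (K : finType) (kappa : point -> K) (d : K -> U),
    (forall k, definable [set x | kappa x = k]) /\
    forall x, phi x = d (kappa x).

Lemma simple_definable_set (X : point -> bool) :
  simple_definable X <-> definable [set x | X x].
Proof.
split=> [[K [kappa [d [dk Xd]]]]|dX]; last first.
  exists bool, X, id; split=> // b.
  case: b => //.
  have /definable_expressible/expressible_not dC := dX.
  apply/definable_expressible; apply: expressible_iff dC _ => x /=.
  by split=> [/negP/negbTE|->].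
apply/definable_expressible.
have dXk k : expressible (fun x : 'I_n -> S => d k /\ kappa x = k).
  have /definable_expressible dkk := dk k.
  case: (boolP (d k)) => _.
    by apply: expressible_iff dkk _ => x; split=> // -[].
  by apply: expressible_iff (expressible_False _ _) _ => x; split=> // -[].
apply: expressible_iff (expressible_exists_fin dXk) _ => x /=.
rewrite Xd; split=> [[k [dkk ->]] //|dkx].
by exists (kappa x).
Qed.

Lemma simple_definable_cst U (u : U) : simple_definable (fun=> u).
Proof.
exists unit, (fun=> tt), (fun=> u); split=> // -[].
apply/definable_expressible.
apply: expressible_iff (expressible_not (expressible_False _ _)) _ => x.
by split=> // _; exact.
Qed.

Lemma simple_definable_comp U V (F : U -> V) (phi : point -> U) :
  simple_definable phi -> simple_definable (fun x => F (phi x)).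
Proof.
case=> K [kappa [d [dk phid]]]; exists K, kappa, (F \o d); split=> // x.
by rewrite phid.
Qed.

(** The common refinement of the partitions, labelled by dependent functions, serves all members at
    once. *)
Lemma simple_definable_family (J : finType) U (phi : J -> point -> U) :
  (forall j, simple_definable (phi j)) ->
  simple_definable (fun x j => phi j x).
Proof.
move=> /(_ _)/cid-/all_sig[K] /(_ _)/cid-/all_sig[kappa] /(_ _)/cid-/all_sig[d] dP.
exists {dffun forall j, K j}, (fun x => [ffun j => kappa j x]),
  (fun (f : {dffun forall j, K j}) j => d j (f j)).
split=> [k|x]; last by apply: funext => j; rewrite ffunE (dP j).2.
apply/definable_expressible.
have dN j : expressible (fun x : 'I_n -> S => ~ (kappa j x = k j)).
  apply: expressible_not; apply/definable_expressible.
  exact: (dP j).1.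
apply: expressible_iff (expressible_not (expressible_exists_fin dN)) _ => x.
split=> [Nx|/= kx [j]]; last by rewrite -kx ffunE.
apply/ffunP => j; rewrite ffunE.
by apply: contrapT => Nj; apply: Nx; exists j.
Qed.

Lemma simple_definable_comp2 U V W (F : U -> V -> W) (phi : point -> U)
    (psi : point -> V) :
  simple_definable phi -> simple_definable psi ->
  simple_definable (fun x => F (phi x) (psi x)).
Proof.
move=> [K [kappa [d [dk phid]]]] [K' [kappa' [d' [dk' psid]]]].
exists (K * K')%type, (fun x => (kappa x, kappa' x)), (fun k => F (d k.1) (d' k.2)).
split=> [[k k']|x]; last by rewrite phid psid.
have /definable_expressible dkk := dk k.
have /definable_expressible dkk' := dk' k'.
apply/definable_expressible.
apply: expressible_iff (expressible_and dkk dkk') _ => x /=.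
by split=> [[-> ->]|[]].
Qed.

Lemma simple_definable_preimage U (f : point -> point) (phi : point -> U) :
  definable_rel (graph_on setT f) ->
  simple_definable phi -> simple_definable (phi \o f).
Proof.
move=> df [K [kappa [d [dk phid]]]]; exists K, (kappa \o f), d.
by split=> [k|x]; [exact: definable_preimage df (dk k)|rewrite /= phid].
Qed.

Lemma simple_definable_ltn (phi : point -> nat) :
  simple_definable phi -> exists m, forall x, phi x < m.
Proof.
case=> K [kappa [d [_ phid]]]; exists (\max_k d k).+1 => x.
by rewrite phid ltnS leq_bigmax.
Qed.

End SimpleFunctions.

(** * Comparing definable functions by pieces of isomorphisms *)

Section Transport.
Context (L : fo_language) (S : fo_structure L) (n : nat).
Local Notation point := (pt S n).
Context (I : set (point -> point)) (hI : isomorphism_set I) (hid : I id).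

Lemma isomorphism_definable f : I f -> definable_rel (graph_on setT f).
Proof. by case: hI => + _ _ => /[apply] -[]. Qed.

Lemma isomorphism_inverse f :
  I f -> exists h, [/\ I h, cancel f h & cancel h f].
Proof.
case: hI => + _ inv If => /(_ _ If)[[h fK hK] _].
by exists h; split=> //; exact: inv fK hK.
Qed.

(** An isomorphism cut down to a definable domain. The inverse is kept as data so that arrivals at a
    point can be tested through [bwd]. *)
Record piece := Piece {
  dom : point -> bool;
  fwd : point -> point;
  bwd : point -> point;
  dom_def : simple_definable dom;
  fwd_iso : I fwd;
  bwd_iso : I bwd;
  fwdK : cancel fwd bwd;
  bwdK : cancel bwd fwd }.

Definition outdeg (s : seq piece) x := count (fun t => dom t x) s.
Definition indeg (s : seq piece) y := count (fun t => dom t (bwd t y)) s.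

Lemma outdeg_cat s s' x : outdeg (s ++ s') x = outdeg s x + outdeg s' x.
Proof. exact: count_cat. Qed.

Lemma indeg_cat s s' x : indeg (s ++ s') x = indeg s x + indeg s' x.
Proof. exact: count_cat. Qed.

(* [phi] and [psi] stand for formal sums of definable sets: [phi] copies over
   each point are moved by finitely many pieces, at most [psi] of which land on
   a given point. *)
Definition transport_le (phi psi : point -> nat) :=
  exists s, (forall x, phi x <= outdeg s x) /\ (forall y, indeg s y <= psi y).
Local Notation "phi <~ psi" := (transport_le phi psi) (at level 70).

Lemma transport_mono phi phi' psi psi' :
  (forall x, phi' x <= phi x) -> (forall x, psi x <= psi' x) ->
  phi <~ psi -> phi' <~ psi'.
Proof.
move=> le1 le2 [s [os is_]].
by exists s; split=> x; [exact: leq_trans (os x) | exact: leq_trans (is_ x) _].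
Qed.

Lemma transport0 psi : (fun=> 0) <~ psi.
Proof. by exists [::]. Qed.

Lemma transportD phi phi' psi psi' :
  phi <~ psi -> phi' <~ psi' ->
  (fun x => phi x + phi' x) <~ (fun x => psi x + psi' x).
Proof.
move=> [s [os is_]] [s' [os' is']]; exists (s ++ s').
split=> x; rewrite ?outdeg_cat ?indeg_cat.
  by apply: leq_add; [exact: os | exact: os'].
by apply: leq_add; [exact: is_ | exact: is'].
Qed.

Lemma transport_sum (J : finType) (phi psi : J -> point -> nat) :
  (forall j, phi j <~ psi j) ->
  (fun x => \sum_j phi j x) <~ (fun x => \sum_j psi j x).
Proof.
move=> le_; suff: (fun x => \sum_(j <- index_enum J) phi j x) <~
  (fun x => \sum_(j <- index_enum J) psi j x) by [].
elim: (index_enum J) => [|j s IH].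
  by apply: transport_mono (transport0 (fun=> 0)) => x; rewrite big_nil.
by apply: transport_mono (transportD (le_ j) IH) => x; rewrite big_cons.
Qed.

Lemma transportM c phi psi :
  phi <~ psi -> (fun x => c * phi x) <~ (fun x => c * psi x).
Proof.
move=> le_; apply: transport_mono (transport_sum (fun _ : 'I_c => le_)) => x;
  by rewrite sum_nat_const card_ord.
Qed.

(** * Operations on pieces, transitivity and approximate cancellation *)

Section Restrict.
Context (X : point -> bool) (dX : simple_definable X) (t : piece).

Definition restrict := Piece
  (simple_definable_comp2 andb dX (dom_def t)) (fwd_iso t) (bwd_iso t)
  (fwdK t) (bwdK t).
End Restrict.

Section Precompose.
Context (f g : point -> point) (If : I f) (Ig : I g).
Context (fK : cancel f g) (gK : cancel g f).

Lemma precompose_subproof t :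
  [/\ simple_definable (dom t \o f), I (fwd t \o f) & I (g \o bwd t)].
Proof.
case: hI => _ comp _; split.
- exact: simple_definable_preimage (isomorphism_definable If) (dom_def t).
- exact: comp If (fwd_iso t).
- exact: comp (bwd_iso t) Ig.
Qed.

Definition precompose t :=
  let: And3 d1 d2 d3 := precompose_subproof t in
  Piece d1 d2 d3 (can_comp (fwdK t) fK) (can_comp gK (bwdK t)).

Lemma outdeg_precompose s x : outdeg [seq precompose t | t <- s] x = outdeg s (f x).
Proof.
rewrite /outdeg count_map; apply: eq_count => t /=; rewrite /precompose.
by case: precompose_subproof.
Qed.

Lemma indeg_precompose s y : indeg [seq precompose t | t <- s] y = indeg s y.
Proof.
rewrite /indeg count_map; apply: eq_count => t /=; rewrite /precompose.
by case: precompose_subproof => /= *; rewrite gK.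
Qed.
End Precompose.

(** Greedy choice: a point of [X] puts the first piece of [s] defined there into [s1]; every other
    use of a piece stays in [s2]. *)
Lemma split_off (X : point -> bool) s :
  simple_definable X -> (forall x, X x <= outdeg s x) ->
  exists s1 s2, [/\ forall x, X x <= outdeg s1 x,
    forall x, outdeg s x <= X x + outdeg s2 x
    & forall y, indeg s1 y + indeg s2 y = indeg s y].
Proof.
elim: s X => [|t s IH] X dX Xs; first by exists [::], [::].
have dXN : simple_definable (fun x => X x && ~~ dom t x).
  exact: (simple_definable_comp2 (fun a b => a && ~~ b)) dX (dom_def t).
have dNX : simple_definable (fun x => ~~ X x) := simple_definable_comp _ dX.
have [|s1 [s2 [s1P s2P s12]]] := IH _ dXN.
  by move=> x; have := Xs x; rewrite /outdeg /=; case: (X x); case: (dom t x).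
exists (restrict dX t :: s1), (restrict dNX t :: s2); split=> x.
- by have := s1P x; rewrite /outdeg /=; case: (X x); case: (dom t x) => //=; lia.
- by have := s2P x; rewrite /outdeg /=; case: (X x); case: (dom t x) => //=; lia.
- by have := s12 x; rewrite /indeg /=; case: (X _); case: (dom t _) => //=; lia.
Qed.

(** Pieces are composed one at a time: for each [t] in [s1], enough is split off from [s2] to move
    the image of [t] onwards, and what is left of [s2] suffices for the rest of [s1]. *)
Lemma transport_trans phi psi chi : phi <~ psi -> psi <~ chi -> phi <~ chi.
Proof.
move=> [s1 [os1 is1]] [s2 [os2 is2]].
have {psi is1 os2} le12 y : indeg s1 y <= outdeg s2 y.
  exact: leq_trans (is1 y) (os2 y).
suff [s [sP1 sP2]] : exists s, (forall x, outdeg s1 x <= outdeg s x) /\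
    (forall y, indeg s y <= indeg s2 y).
  exists s; split=> x; [exact: leq_trans (os1 x) _ | exact: leq_trans (sP2 x) _].
elim: s1 s2 {phi chi os1 is2} le12 => [|t s1 IH] s2 le12; first by exists [::].
have dX : simple_definable (dom t \o bwd t).
  exact: simple_definable_preimage (isomorphism_definable (bwd_iso t)) (dom_def t).
have [|s [s2' [sP s2P s2E]]] := split_off dX (s := s2).
  by move=> y; apply: leq_trans (le12 y); rewrite /indeg /= leq_addr.
have [|s' [s'P1 s'P2]] := IH s2'.
  by move=> y; have := leq_trans (le12 y) (s2P y); rewrite /indeg /= leq_add2l.
exists ([seq precompose (fwd_iso t) (bwd_iso t) (fwdK t) (bwdK t) u | u <- s] ++ s').
split=> x; rewrite ?outdeg_cat ?indeg_cat.
  rewrite outdeg_precompose [outdeg (t :: s1) x]/outdeg /=.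
  apply: leq_add; last exact: s'P1.
  by apply: leq_trans (sP _); rewrite /= fwdK.
by rewrite indeg_precompose -s2E leq_add2l; exact: s'P2.
Qed.

(** A definable [phi] is bounded, hence a finite sum of indicators of the sets [j < phi x]; each of
    these is moved by [f] as one piece. *)
Lemma transport_iso phi f g :
  simple_definable phi -> I f -> I g -> cancel f g -> cancel g f ->
  phi <~ (phi \o g).
Proof.
move=> dphi If Ig fK gK; have [m phi_lt] := simple_definable_ltn dphi.
have E x : phi x = \sum_(j < m) (j < phi x).
  rewrite -(big_mkord xpredT (fun j => (j < phi x) : nat)).
  move: (phi x) (phi_lt x) => p; elim: m p {phi_lt} => // m IH [|p] pm.
    by rewrite big1.
  by rewrite big_nat_recl // -IH.
apply: (@transport_mono (fun x => \sum_(j < m) (j < phi x)) _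
  (fun y => \sum_(j < m) (j < phi (g y)))).
- by move=> x; rewrite -E.
- by move=> x; rewrite /= [leqRHS]E.
apply: transport_sum => j.
exists [:: Piece (simple_definable_comp (fun p => j < p) dphi) If Ig fK gK].
by split=> x; rewrite /outdeg /indeg /= addn0.
Qed.

Lemma transport_refl phi : simple_definable phi -> phi <~ phi.
Proof. by move=> dphi; exact: transport_iso dphi hid hid _ _. Qed.

(** Here [chi] is a catalyst: in its presence the copies of [phi] are exchanged for copies of [psi]
    one by one. The same [chi] is reused, so the error does not grow with [c]. *)
Lemma transport_cancel c phi psi chi :
  simple_definable phi -> simple_definable psi ->
  (fun x => phi x + chi x) <~ (fun x => psi x + chi x) ->
  simple_definable chi ->
  (fun x => c * phi x) <~ (fun x => c * psi x + chi x).
Proof.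
move=> dphi dpsi le1 dchi.
suff: (fun x => c * phi x + chi x) <~ (fun x => c * psi x + chi x).
  by apply: transport_mono => // x; rewrite leq_addr.
elim: c => [|c IH]; first exact: transport_refl.
apply: (transport_trans (psi := fun x => phi x + (c * psi x + chi x))).
  apply: transport_mono (transportD (transport_refl dphi) IH) => x //.
  by rewrite mulSn addnA.
have dcpsi : simple_definable (fun x => c * psi x) := simple_definable_comp _ dpsi.
by apply: transport_mono (transportD (transport_refl dcpsi) le1) => x;
  rewrite ?mulSn; lia.
Qed.

(** The rank of an entry satisfying [a] is the number of such entries before it. This lemma and the
    next two make ranks a bijection onto the numbers below [count a s]. *)
Lemma rank_exists (T : Type) (x0 : T) (a : pred T) s c :
  c < count a s ->
  exists i, [/\ i < size s, a (nth x0 s i) & count a (take i s) = c].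
Proof.
elim: s c => //= x s IH c; case ax: (a x) => /=; last first.
  by move=> /IH[i [ilt ai <-]]; exists i.+1; rewrite /= ax.
case: c => [_|c]; first by exists 0.
by rewrite ltnS => /IH[i [ilt ai <-]]; exists i.+1; rewrite /= ax.
Qed.

Lemma rank_lt (T : Type) (x0 : T) (a : pred T) s i :
  i < size s -> a (nth x0 s i) -> count a (take i s) < count a s.
Proof.
move=> ilt ai; rewrite -[in ltnRHS](cat_take_drop i s) count_cat.
by rewrite (drop_nth x0) //= ai -addSnnS leq_addr.
Qed.

Lemma rank_inj (T : Type) (x0 : T) (a : pred T) s i j :
  i < size s -> j < size s -> a (nth x0 s i) -> a (nth x0 s j) ->
  count a (take i s) = count a (take j s) -> i = j.
Proof.
wlog ij : i j / i < j => [W|] ilt jlt ai aj E.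
  by case: (ltngtP i j) => // ?; [|apply/esym]; exact: W.
have := rank_lt (s := take j s) (i := i) (a := a) (x0 := x0).
rewrite size_takel ?(ltnW jlt) // nth_take // take_takel ?(ltnW ij) // E ltnn.
by move=> /(_ ij ai).
Qed.

Lemma simple_definable_outdeg s : simple_definable (outdeg s).
Proof.
elim: s => [|t s IH]; first exact: simple_definable_cst.
exact: (simple_definable_comp2 (fun (b : bool) m => b + m)) (dom_def t) IH.
Qed.

Lemma simple_definable_indeg s : simple_definable (indeg s).
Proof.
elim: s => [|t s IH]; first exact: simple_definable_cst.
apply: (simple_definable_comp2 (fun (b : bool) m => b + m)) IH.
exact: simple_definable_preimage (isomorphism_definable (bwd_iso t)) (dom_def t).
Qed.

(* A copy of [x] is moved by the piece whose rank among those defined at [x] is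
   the number of this copy, and lands in the copy of [Y] numbered by the rank of
   the piece among those arriving at the same point. *)
Lemma transport_copies_le p q (X Y : point -> bool) :
  simple_definable X ->
  (fun x => p * X x) <~ (fun y => q * Y y) ->
  copies_le I (copies p [set x | X x]) (copies q [set y | Y y]).
Proof.
move=> dX [s [os is_]].
(* Only a default for [nth]: every position occurring in [K] is below [size s]. *)
pose t0 := Piece (simple_definable_cst S n false) hid hid
  (fun=> erefl) (fun=> erefl).
(* A label holds the position of a piece in [s], the copy of [X] it starts from and the copy of [Y]
   it reaches. *)
pose K := ('I_(size s) * 'I_p * 'I_q)%type.
pose t (k : K) := nth t0 s k.1.1.
pose Q (k : K) x := [&& X x, dom (t k) x, outdeg (take k.1.1 s) x == k.1.2
  & indeg (take k.1.1 s) (fwd (t k) x) == k.2].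
have dQ k : simple_definable (Q k).
  apply: (simple_definable_comp2 andb) dX _.
  apply: (simple_definable_comp2 andb) (dom_def _) _.
  apply: (simple_definable_comp2 andb).
    exact: (simple_definable_comp (eq_op^~ _)) (simple_definable_outdeg _).
  apply: (simple_definable_comp (eq_op^~ _)).
  exact: simple_definable_preimage (isomorphism_definable (fwd_iso _))
    (simple_definable_indeg _).
(* The rank of a piece among the arrivals at [y] is below [indeg s y], hence below [q * Y y]; this
   forces both [Y y] and a rank below [q]. *)
have landing x (i : 'I_(size s)) : dom (nth t0 s i) x ->
    Y (fwd (nth t0 s i) x) /\ indeg (take i s) (fwd (nth t0 s i) x) < q.
  move=> domx; have := is_ (fwd (nth t0 s i) x).
  have := rank_lt (a := fun u => dom u (bwd u (fwd (nth t0 s i) x))) (ltn_ord i).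
  move=> /(_ t0); rewrite fwdK => /(_ domx); rewrite -/(indeg _ _) -/(indeg _ _).
  by move=> lt le_; have := leq_trans lt le_; case: (Y _); rewrite ?muln0 ?muln1.
exists #|{: K}|, (fun j => [set x | Q (enum_val j) x]),
  (fun j => (enum_val j).1.2), (fun j => (enum_val j).2),
  (fun j => fwd (t (enum_val j))); split.
- by move=> j; split; [exact/simple_definable_set | exact: fwd_iso].
- move=> j j' _ _ [[c x] [[/= cE Qx] [/= cE' Qx']]]; apply: enum_val_inj.
  move: (enum_val j) (enum_val j') Qx Qx' cE cE' => [[i c1] d] [[i' c1'] d'].
  move=> /and4P[_ /= dx /eqP/= oi /eqP/= ii] /and4P[_ /= dx' /eqP/= oi' /eqP/= ii'] cE cE'.
  (* The source copy is the rank at [x], so equal copies come from the same piece. *)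
  have E : i = i'.
    apply/val_inj/(rank_inj (a := fun u => dom u x) (x0 := t0) (ltn_ord i) (ltn_ord i') dx dx').
    by move: oi oi'; rewrite /outdeg -cE -cE' => -> ->.
  by subst i'; congr (_, _, _); [rewrite -cE -cE' | exact/val_inj/(etrans (esym ii) ii')].
- apply/predeqP => -[c x]; split=> [[j _ [/= _ /andP[]]] //|/= Xx].
  have cs : c < outdeg s x.
    by apply: leq_trans (os x); rewrite Xx muln1.
  have [i [ilt domi ci]] := rank_exists t0 cs.
  have [_ dlt] := landing x (Ordinal ilt) domi.
  exists (enum_rank (Ordinal ilt, c, Ordinal dlt)) => //.
  by split; rewrite /= enum_rankK //; apply/and4P; split=> //=; apply/eqP.
- move=> j j' _ _ [[d y] [[/= dE [x Qx xy]] [/= dE' [x' Qx' xy']]]].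
  apply: enum_val_inj.
  move: (enum_val j) (enum_val j') Qx Qx' dE dE' xy xy' => [[i c] d1] [[i' c'] d1'].
  move=> /and4P[_ /= dx /eqP/= oi /eqP/= ii] /and4P[_ /= dx' /eqP/= oi' /eqP/= ii'].
  rewrite /t /= => dE dE' xy xy'; rewrite /t /= in dx dx' ii ii'.
  have E : i = i'.
    apply/val_inj/(rank_inj (a := fun u => dom u (bwd u y)) (ltn_ord i) (ltn_ord i') (x0 := t0)).
    + by rewrite -xy fwdK.
    + by rewrite -xy' fwdK.
    + by rewrite -/(indeg _ _) -/(indeg _ _) -{1}xy ii -xy' ii' -dE -dE'.
  subst i'; have xx' : x = x'.
    by rewrite -(fwdK (nth t0 s i) x) xy -xy' fwdK.
  subst x'; congr (_, _, _); last by rewrite -dE -dE'.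
  exact/val_inj/(etrans (esym oi) oi').
- move=> j [d y] [/= _ [x /and4P[_ domx _ _] <-]].
  by have [] := landing _ _ domx.
Qed.
(** * The auction *)

Section Auction.
Context (J : finType) (Q : J -> point -> bool) (g h : J -> point -> point).
Context (dQ : forall c, simple_definable (Q c)).
Context (Ig : forall c, I (g c)) (Ih : forall c, I (h c)).
Context (gK : forall c, cancel (g c) (h c)) (hK : forall c, cancel (h c) (g c)).

(** Double counting: [W c x] is a weight on the edge from [x] to [g c x], read at the left end and
    then at the right end. *)
Lemma transport_edges (W : J -> point -> nat) :
  (forall c, simple_definable (W c)) ->
  (fun x => \sum_c W c x) <~ (fun y => \sum_c W c (h c y)).
Proof.
by move=> dW; apply: transport_sum => c; exact: transport_iso (gK c) (hK c).
Qed.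

Lemma transport_edgesV (W : J -> point -> nat) :
  (forall c, simple_definable (W c)) ->
  (fun y => \sum_c W c (h c y)) <~ (fun x => \sum_c W c x).
Proof.
move=> dW; apply: transport_sum => c.
have dWh : simple_definable (W c \o h c).
  exact: simple_definable_preimage (isomorphism_definable (Ih c)) (dW c).
apply: transport_mono (transport_iso dWh (Ih c) (Ig c) (hK c) (gK c)) => // x.
by rewrite /= gK.
Qed.

(** The choice depends only on the predicate on the finite type [J], so it is definable when the
    predicate varies definably with a point. *)
Definition selected (P : pred J) c := [pick c' | P c'] == Some c.

Lemma selectedP (P : pred J) c : selected P c -> P c.
Proof. by rewrite /selected; case: pickP => // c' Pc' /eqP[<-]. Qed.

Lemma sum_selected (P : pred J) : \sum_c selected P c = [exists c, P c].
Proof.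
rewrite /selected; case: pickP => [c Pc|P0].
  have -> : [exists c, P c] by apply/existsP; exists c.
  rewrite (bigD1 c) //= eqxx big1 ?addn0 // => c' c'c.
  by rewrite (inj_eq Some_inj) eq_sym (negbTE c'c).
have -> : [exists c, P c] = false by apply/existsP => -[c]; rewrite P0.
by rewrite big1.
Qed.

Lemma sum_bool_le1 (P : pred J) :
  \sum_c P c <= 1 -> \sum_c P c = [exists c, P c].
Proof.
case: (boolP [exists c, P c]) => [/existsP[c Pc]|/existsPn P0 _].
  by rewrite (bigD1 c) //= Pc; case: (\sum_(_ | _) _).
by rewrite big1 // => c _; rewrite (negbTE (P0 c)).
Qed.

Lemma sum_bool_le1_inj (P : pred J) c c' :
  \sum_c P c <= 1 -> P c -> P c' -> c = c'.
Proof.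
move=> le1 Pc Pc'; apply/eqP/negPn/negP => cc'; move: le1.
rewrite (bigD1 c) // (bigD1 c') /=; last by rewrite eq_sym.
by rewrite Pc Pc'.
Qed.

Context (D : nat).

Definition active (M : J -> point -> bool) (p : point -> nat) x :=
  ~~ [exists c, M c x] && [exists c, Q c x && (p (g c x) < D)].

(* [M c x] says that [x] holds the object [g c x], and [p] gives the prices,
   after [s] rounds. *)
Record auction_state s (M : J -> point -> bool) (p : point -> nat) : Prop := {
  holding_definable : forall c, simple_definable (M c);
  price_definable : simple_definable p;
  holding_edge : forall c x, M c x -> Q c x;
  holding_left : forall x, \sum_c M c x <= 1;
  holding_right : forall y, \sum_c M c (h c y) <= 1;
  price_le : forall y, p y <= D;
  price_sold : forall y, 0 < p y -> [exists c, M c (h c y)];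
  price_slack : forall c c' x, M c x -> Q c' x -> p (g c x) <= (p (g c' x)).+1;
  active_le : (fun x => s * active M p x) <~ (fun y => #|J| * p y) }.

Lemma simple_definable_exists (M : J -> point -> bool) :
  (forall c, simple_definable (M c)) ->
  simple_definable (fun x => [exists c, M c x]).
Proof.
move=> /simple_definable_family dM.
exact: (simple_definable_comp (fun f : J -> bool => [exists c, f c])) dM.
Qed.

Lemma simple_definable_sum (W : J -> point -> nat) :
  (forall c, simple_definable (W c)) ->
  simple_definable (fun x => \sum_c W c x).
Proof.
move=> /simple_definable_family dW.
exact: (simple_definable_comp (fun f : J -> nat => \sum_c f c)) dW.
Qed.

Lemma simple_definable_iso U f (phi : point -> U) :
  I f -> simple_definable phi -> simple_definable (fun x => phi (f x)).
Proof.
by move=> If dphi; exact: simple_definable_preimage (isomorphism_definable If) dphi.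
Qed.

Lemma simple_definable_active M p :
  (forall c, simple_definable (M c)) -> simple_definable p ->
  simple_definable (active M p).
Proof.
move=> dM dp.
apply: (simple_definable_comp2 (fun a b : bool => ~~ a && b)).
  exact: simple_definable_exists.
apply: simple_definable_exists => c.
apply: (simple_definable_comp2 (fun (a : bool) m => a && (m < D))) (dQ c) _.
exact: simple_definable_iso (Ig c) dp.
Qed.

(** * One round of the auction *)

Section Round.
Context (s : nat) (M : J -> point -> bool) (p : point -> nat).
Context (st : auction_state s M p).

Definition cheapest x c :=
  Q c x && [forall c', Q c' x ==> (p (g c x) <= p (g c' x))].
Definition bid c x := active M p x && selected (cheapest x) c.
Definition offered y := [exists c, bid c (h c y)].
(** The bidders for an object are named by the colours of their edges to it, so selecting a colour
    selects one bidder. *)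
Definition wins c x := selected (fun c' => bid c' (h c' (g c x))) c.
Definition next_holding c x := (M c x && ~~ offered (g c x)) || wins c x.
Definition next_price y := p y + offered y.

Lemma bid_definable c : simple_definable (bid c).
Proof.
apply: (simple_definable_comp2 andb).
  exact: simple_definable_active (holding_definable st) (price_definable st).
(* Apart from activity, a bid depends only on this family over the colours, which takes finitely
   many values. *)
have dF : simple_definable (fun x c => (Q c x, p (g c x))).
  apply: simple_definable_family => c'.
  apply: (simple_definable_comp2 pair) (dQ c') _.
  exact: simple_definable_iso (Ig c') (price_definable st).
exact: (simple_definable_comp (fun f : J -> bool * nat => selected (fun c =>
  (f c).1 && [forall c', (f c').1 ==> ((f c).2 <= (f c').2)]) c)) dF.
Qed.

Lemma offered_definable : simple_definable offered.
Proof.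
apply: simple_definable_exists => c.
exact: simple_definable_iso (Ih c) (bid_definable c).
Qed.

Lemma wins_definable c : simple_definable (wins c).
Proof.
have dF : simple_definable (fun x c' => bid c' (h c' (g c x))).
  apply: simple_definable_family => c'.
  have dbh := simple_definable_iso (Ih c') (bid_definable c').
  exact: simple_definable_iso (Ig c) dbh.
exact: (simple_definable_comp (fun f : J -> bool => selected f c)) dF.
Qed.

Lemma next_holding_definable c : simple_definable (next_holding c).
Proof.
apply: (simple_definable_comp2 orb) (wins_definable c).
apply: (simple_definable_comp2 (fun a b : bool => a && ~~ b)).
  exact: holding_definable st c.
exact: simple_definable_iso (Ig c) offered_definable.
Qed.

Lemma next_price_definable : simple_definable next_price.
Proof.
exact: (simple_definable_comp2 (fun m (b : bool) => m + b))
  (price_definable st) offered_definable.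
Qed.

(** An active vertex has a neighbour, hence a cheapest one, and exactly one colour is selected. *)
Lemma sum_bid x : \sum_c bid c x = active M p x.
Proof.
rewrite /bid; case actx: (active M p x) => /=; last by rewrite big1.
rewrite sum_selected; case/andP: actx => _ /existsP[c /andP[Qc _]].
suff -> : [exists c, cheapest x c] by [].
case: (arg_minnP (P := Q^~ x) (fun c => p (g c x)) Qc) => c' Qc' c'min.
apply/existsP; exists c'; rewrite /cheapest Qc' /=.
by apply/forallP => c''; apply/implyP; exact: c'min.
Qed.

Lemma wins_bid c x : wins c x -> bid c x.
Proof. by move=> /selectedP; rewrite gK. Qed.

Lemma bid_offered c x : bid c x -> offered (g c x).
Proof. by move=> bx; apply/existsP; exists c; rewrite gK. Qed.

Lemma sum_wins y : \sum_c wins c (h c y) = offered y.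
Proof.
rewrite -sum_selected; apply: eq_bigr => c _; congr nat_of_bool.
by rewrite /wins hK.
Qed.

Lemma sum_wins_le x : \sum_c wins c x <= active M p x.
Proof.
rewrite -sum_bid; apply: leq_sum => c _.
by case: (boolP (wins c x)) => // /wins_bid ->.
Qed.

(** A vertex active after the round either was active and won nothing, or has just lost its object;
    as prices never fall, there is no other way to become active. *)
Lemma active_next_le x :
  active next_holding next_price x + \sum_c wins c x <=
  active M p x + \sum_c (M c x && offered (g c x)).
Proof.
case: (boolP (active next_holding next_price x)); last first.
  by move=> _; apply: leq_trans (sum_wins_le x) _; rewrite leq_addr.
case/andP=> /existsPn nM' /existsP[c /andP[Qc pc]].
rewrite big1 => [|c' _]; last first.
  by have /norP[_ /negbTE ->] := nM' c'.
rewrite addn0; case: (boolP [exists c, M c x]) => [/existsP[c' Mc']|nM].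
  have /norP[+ _] := nM' c'; rewrite Mc' /= negbK => off.
  by rewrite (bigD1 c') //= Mc' off addnCA leq_addr.
suff -> : active M p x by rewrite leq_addr.
rewrite /active nM; apply/existsP; exists c; rewrite Qc /=.
by apply: leq_ltn_trans pc; rewrite leq_addr.
Qed.

(** An object that receives a bid releases at most one holder and gains exactly one winner, so
    released vertices are compared with winners through the objects. *)
Lemma active_next_transport :
  (active next_holding next_price : point -> nat) <~ (active M p : point -> nat).
Proof.
have dO c : simple_definable (fun x => M c x && offered (g c x)).
  apply: (simple_definable_comp2 andb) (holding_definable st c) _.
  exact: simple_definable_iso (Ig c) offered_definable.
have dO' c : simple_definable (fun x => (M c x && offered (g c x) : nat)).
  exact: simple_definable_comp.
have dw c : simple_definable (fun x => (wins c x : nat)).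
  exact: simple_definable_comp (wins_definable c).
have out_le : (fun x => \sum_c (M c x && offered (g c x))) <~
    (fun x => \sum_c wins c x).
  apply: transport_trans (transport_edges dO') _.
  apply: transport_mono (transport_edgesV dw) => // y.
  under eq_bigr do rewrite hK.
  rewrite sum_wins; case: (offered y).
    by under eq_bigr do rewrite andbT; exact: holding_right st y.
  by rewrite big1 // => c _; rewrite andbF.
(* The truncated subtraction is exact: winners are active and win along a single colour. *)
have dl : simple_definable (fun x => active M p x - \sum_c wins c x).
  apply: (simple_definable_comp2 (fun (a : bool) m => a - m)).
    exact: simple_definable_active (holding_definable st) (price_definable st).
  exact: simple_definable_sum.
apply: transport_mono (transportD (transport_refl dl) out_le) => x.
  have := active_next_le x; have := sum_wins_le x; lia.
by have := sum_wins_le x; lia.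
Qed.

(** For the slack, a kept object has an unchanged price while the others can only become dearer, and
    a newly won one was cheapest when bid for and rose by one. The ceiling [D] persists because
    active vertices have a neighbour of price below [D]. *)
Lemma auction_round : auction_state s.+1 next_holding next_price.
Proof.
have pri y := leq_addr (offered y) (p y).
split.
- exact: next_holding_definable.
- exact: next_price_definable.
- move=> c x /orP[/andP[/(holding_edge st)]//|/wins_bid].
  by case/andP => _ /selectedP /andP[].
- move=> x; case: (boolP [exists c, M c x]) => [Mx|/existsPn nM].
    apply: leq_trans (holding_left st x); apply: leq_sum => c _.
    rewrite /next_holding; case: (boolP (wins c x)) => [/wins_bid|_].
      by rewrite /bid /active Mx.
    by rewrite orbF; case: (M c x) => //; case: (~~ _).
  apply: (@leq_trans (\sum_c wins c x)).
    by apply: leq_sum => c _; rewrite /next_holding (negbTE (nM c)).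
  exact: leq_trans (sum_wins_le x) (leq_b1 _).
- move=> y; under eq_bigr do rewrite /next_holding hK.
  case: (boolP (offered y)) => offy.
    by under eq_bigr do rewrite andbF /=; rewrite sum_wins leq_b1.
  apply: leq_trans (holding_right st y); apply: leq_sum => c _; rewrite andbT.
  case: (boolP (wins c (h c y))); last by rewrite orbF.
  by move=> /wins_bid/bid_offered; rewrite hK (negbTE offy).
- move=> y; rewrite /next_price; case: (boolP (offered y)); last first.
    by rewrite addn0 => _; exact: price_le st y.
  case/existsP=> c /andP[/andP[_ /existsP[c' /andP[Qc' pc']]]].
  case/selectedP/andP => _ /forallP/(_ c')/implyP/(_ Qc').
  by rewrite hK addn1 => le_; exact: leq_ltn_trans pc'.
- move=> y; rewrite /next_price => py; apply/existsP.
  case: (boolP (offered y)) py => offy; last first.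
    rewrite addn0 => /(price_sold st)/existsP[c Mc]; exists c.
    by rewrite /next_holding Mc hK offy.
  move=> _; have : 0 < \sum_c wins c (h c y) by rewrite sum_wins offy.
  rewrite lt0n sum_nat_eq0 => /forallPn[c]; rewrite eqb0 negbK => wc.
  by exists c; rewrite /next_holding wc orbT.
- move=> c c' x /orP[/andP[Mc off]|/wins_bid bc] Qc'.
    rewrite /next_price (negbTE off) addn0.
    apply: leq_trans (price_slack st Mc Qc') _.
    by rewrite ltnS leq_addr.
  case/andP: bc => _ /selectedP/andP[_ /forallP/(_ c')/implyP/(_ Qc') le_].
  rewrite /next_price -addn1; apply: leq_add (leq_b1 _).
  exact: leq_trans le_ (leq_addr _ _).
have db c : simple_definable (fun x => (bid c x : nat)).
  exact: simple_definable_comp (bid_definable c).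
(* Every active vertex bids, and at most one bid of each colour reaches an object, whose price then
   rises by one. *)
have act_le : (active M p : point -> nat) <~ (fun y => #|J| * offered y).
  apply: transport_mono (transport_edges db) => x; first by rewrite sum_bid.
  apply: (@leq_trans (\sum_(c : J) offered x)); last first.
    by rewrite sum_nat_const.
  apply: leq_sum => c _; case: (boolP (bid c (h c x))) => // /bid_offered.
  by rewrite hK => ->.
(* As activity does not grow, the [s.+1] new copies compare with one old copy, charged to this
   round, and [s] old copies, charged to the earlier rounds. *)
apply: (transport_trans (psi := fun x => s.+1 * active M p x)).
  exact: transportM active_next_transport.
apply: transport_mono (transportD act_le (active_le st)) => x.
  by rewrite mulSn.
by rewrite /next_price; lia.
Qed.

End Round.

Lemma auction_run s : exists M p, auction_state s M p.
Proof.
elim: s => [|s [M [p st]]]; last first.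
  by exists (next_holding M p), (next_price M p); exact: auction_round.
exists (fun _ _ => false), (fun=> 0); split=> // [c||x|y|].
- exact: simple_definable_cst.
- exact: simple_definable_cst.
- by rewrite big1.
- by rewrite big1.
- by apply: transport_mono (transport0 (fun=> 0)).
Qed.

(** * Edge counting in a regular graph *)

Section Regular.
Context (k : nat) (A B : point -> bool).
Context (dA : simple_definable A) (dB : simple_definable B).
Context (QA : forall c x, Q c x -> A x) (QB : forall c x, Q c x -> B (g c x)).
Context (degA : forall x, A x -> \sum_c Q c x = k).
Context (degB : forall y, B y -> \sum_c Q c (h c y) = k).
Context (s : nat) (M : J -> point -> bool) (p : point -> nat).
Context (st : auction_state s M p).

Let matchedA x := [exists c, M c x].
Let matchedB y := [exists c, M c (h c y)].

Definition unmatchedA x := A x && ~~ matchedA x.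
Definition unmatchedB y := B y && ~~ matchedB y.
Definition hopeless x := unmatchedA x && ~~ active M p x.

Lemma simple_definable_bool (X : point -> bool) :
  simple_definable X -> simple_definable (X : point -> nat).
Proof. exact: simple_definable_comp. Qed.

Lemma matchedA_definable : simple_definable matchedA.
Proof. exact: simple_definable_exists (holding_definable st). Qed.

Lemma matchedB_definable : simple_definable matchedB.
Proof.
apply: simple_definable_exists => c.
exact: simple_definable_iso (Ih c) (holding_definable st c).
Qed.

Lemma unmatchedA_definable : simple_definable unmatchedA.
Proof.
exact: (simple_definable_comp2 (fun a b => a && ~~ b)) dA matchedA_definable.
Qed.

Lemma unmatchedB_definable : simple_definable unmatchedB.
Proof.
exact: (simple_definable_comp2 (fun a b => a && ~~ b)) dB matchedB_definable.
Qed.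

Lemma active_definable : simple_definable (active M p).
Proof. exact: simple_definable_active (holding_definable st) (price_definable st). Qed.

Lemma hopeless_definable : simple_definable hopeless.
Proof.
exact: (simple_definable_comp2 (fun a b => a && ~~ b))
  unmatchedA_definable active_definable.
Qed.

Lemma matchedB_B y : matchedB y -> B y.
Proof. by case/existsP => c /(holding_edge st)/QB; rewrite hK. Qed.

Lemma price_leB y : p y <= D * B y.
Proof.
have := price_le st y; have := @price_sold _ _ _ st y.
case: (p y) => // m /(_ isT)/matchedB_B ->; by rewrite muln1.
Qed.

(* Count the edges with weight one plus the price of the object: an agent sees
   only prices at least [D] if it is hopeless, and at least the price it paid
   minus one if it is matched. *)
Lemma hopeless_transport :
  (fun x => k * D * hopeless x + k * p x) <~ (fun y => k * B y + k * p y).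
Proof.
pose W c x := Q c x * (p (g c x)).+1.
have dW c : simple_definable (W c).
  apply: (simple_definable_comp2 (fun (a : bool) m => a * m.+1)) (dQ c) _.
  exact: simple_definable_iso (Ig c) (price_definable st).
pose V c x := M c x * p (g c x).
have dV c : simple_definable (V c).
  apply: (simple_definable_comp2 (fun (a : bool) m => a * m)).
    exact: holding_definable st c.
  exact: simple_definable_iso (Ig c) (price_definable st).
(* An object of positive price is held, so its price can be carried over to its holder. *)
have pV : p <~ (fun x => \sum_c V c x).
  apply: transport_mono (transport_edgesV dV) => // y.
  under eq_bigr do rewrite /V hK.
  rewrite -big_distrl /= sum_bool_le1 ?(holding_right st) //.
  by have := @price_sold _ _ _ st y; case: (p y) => // m /(_ isT) ->; rewrite mul1n.
have dG : simple_definable (fun x => k * D * hopeless x).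
  exact: (simple_definable_comp (fun b : bool => k * D * b)) hopeless_definable.
apply: transport_trans (transportD (transport_refl dG) (transportM k pV)) _.
apply: transport_mono (transport_edges dW) => x.
  rewrite /hopeless /unmatchedA /matchedA.
  case: (boolP [exists c, M c x]) => [/existsP[c Mc]|nM].
    rewrite andbF muln0 add0n (bigD1 c) //= big1 => [|c' c'c]; last first.
      rewrite /V; case: (boolP (M c' x)) => // Mc'; case/eqP: c'c.
      exact: sum_bool_le1_inj (holding_left st x) Mc' Mc.
    rewrite addn0 /V Mc mul1n -(degA (QA (holding_edge st Mc))) big_distrl /=.
    apply: leq_sum => c' _; rewrite /W; case: (boolP (Q c' x)) => // Qc'.
    rewrite !mul1n; exact (price_slack st Mc Qc').
  rewrite [\sum_c V c x]big1 => [|c _]; last first.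
    by rewrite /V (negbTE (existsPn nM c)).
  rewrite muln0 addn0 andbT /active nM /=.
  case: (boolP (A x)) => [Ax|]; last by rewrite muln0.
  case: (boolP [exists c, _]) => [|/existsPn nact]; first by rewrite muln0.
  rewrite muln1 -(degA Ax) big_distrl /=; apply: leq_sum => c _.
  rewrite /W; case: (boolP (Q c x)) => // Qc; rewrite !mul1n ltnW // ltnS.
  by have := nact c; rewrite Qc /= -leqNgt.
under eq_bigr do rewrite /W hK.
rewrite -big_distrl /=; case: (boolP (B x)) => Bx.
  by rewrite degB // muln1 mulnS.
rewrite big1 // => c _; apply/eqP; rewrite eqb0.
by apply: contra Bx => /QB; rewrite hK.
Qed.

(** Counting edges compares [k] copies of [B] with [k] copies of [A], and the matching compares the
    matched part of [A] with that of [B]. The term [matchedB] stays on both sides, to be cancelled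
    approximately later. *)
Lemma unmatchedB_transport :
  (fun y => k * unmatchedB y + k * matchedB y) <~
  (fun x => k * (hopeless x + active M p x) + k * matchedB x).
Proof.
have dQ' c : simple_definable (Q c : point -> nat) := simple_definable_bool (dQ c).
have dM' c : simple_definable (M c : point -> nat).
  exact: simple_definable_bool (holding_definable st c).
apply: (transport_trans (psi := fun x => \sum_c Q c x)).
  apply: transport_mono (transport_edgesV dQ') => // y.
  have := @matchedB_B y; rewrite /unmatchedB; case: (boolP (B y)) => [By _|nBy].
    by rewrite (degB By); case: (matchedB y) => /=; rewrite muln1 muln0; lia.
  by case: (matchedB y) => [/(_ isT)|] //; rewrite /= muln0.
have mAB : (matchedA : point -> nat) <~ (matchedB : point -> nat).
  apply: transport_mono (transport_edges dM') => x.
    by rewrite sum_bool_le1 ?(holding_left st).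
  by rewrite sum_bool_le1 ?(holding_right st).
have dR : simple_definable (fun x => k * (hopeless x + active M p x)).
  exact: (simple_definable_comp2 (fun a b : bool => k * (a + b)))
    hopeless_definable active_definable.
apply: transport_mono (transportD (transport_refl dR) (transportM k mAB)) => // x.
case: (boolP (A x)) => [Ax|nAx].
  rewrite degA // /hopeless /unmatchedA Ax.
  by case: (matchedA x); case: (active M p x) => /=; lia.
by rewrite big1 // => c _; apply/eqP; rewrite eqb0; apply: contra nAx; exact: QA.
Qed.

(** The factor [7] is [2] for hopeless vertices, [1] for active ones and [4] for unmatched vertices
    of [B]; the factor [k * #|J|.+1 * D] is a common denominator. *)
Lemma unmatched_transport : 0 < D -> s = D * D * #|J|.+1 ->
  (fun x => D * (k * #|J|.+1 * D) * (unmatchedA x || unmatchedB x)) <~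
  (fun y => 7 * (k * #|J|.+1 * D) * B y).
Proof.
move=> D0 sE; set N := #|J|.+1 in sE *; set K := k * N * D.
have dnat := simple_definable_bool.
have dkp : simple_definable (fun x => k * p x).
  exact: simple_definable_comp (price_definable st).
(* Cancelling [k * p] with multiplicity [D] leaves one error term [k * p], at most [k * D] on [B].
   This equals the main term, whence the [2]. *)
have le_hopeless : (fun x => D * K * hopeless x) <~ (fun y => 2 * K * B y).
  have dG : simple_definable (fun x => k * D * hopeless x).
    exact: (simple_definable_comp (fun b : bool => k * D * b)) hopeless_definable.
  have dkB : simple_definable (fun x => k * B x).
    exact: (simple_definable_comp (fun b : bool => k * b)) dB.
  apply: transport_mono (transportM N (transport_cancel D dG dkB
    hopeless_transport dkp)) => x; first by rewrite /K; lia.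
  apply: (@leq_trans (N * (D * (k * B x) + k * (D * B x)))); last by rewrite /K; lia.
  by rewrite leq_mul2l leq_add2l leq_mul2l price_leB !orbT.
(* The number of rounds is chosen so that [k * s = D * K]. *)
have le_active : (fun x => D * K * active M p x) <~ (fun y => K * B y).
  apply: transport_mono (transportM k (active_le st)) => x.
    by rewrite sE /K; lia.
  apply: (@leq_trans (k * (N * (D * B x)))); last by rewrite /K; lia.
  by rewrite leq_mul2l leq_mul ?orbT ?price_leB.
(* Hopeless and active vertices cost [2 + 1], and the error from cancelling [k * matchedB] costs one
   more. *)
have le_unmatchedB : (fun x => D * K * unmatchedB x) <~ (fun y => 4 * K * B y).
  have dU : simple_definable (fun x => k * unmatchedB x).
    exact: (simple_definable_comp (fun b : bool => k * b)) unmatchedB_definable.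
  have dR : simple_definable (fun x => k * (hopeless x + active M p x)).
    exact: (simple_definable_comp2 (fun a b : bool => k * (a + b)))
      hopeless_definable active_definable.
  have dkm : simple_definable (fun x => k * matchedB x).
    exact: (simple_definable_comp (fun b : bool => k * b)) matchedB_definable.
  have dKB : simple_definable (fun x => K * B x).
    exact: (simple_definable_comp (fun b : bool => K * b)) dB.
  have le1 := transportM (N * D)
    (transport_cancel D dU dR unmatchedB_transport dkm).
  apply: transport_trans (transport_mono _ (fun=> leqnn _) le1) _.
    by move=> x; rewrite /K; lia.
  apply: transport_mono (transportD (transportD le_hopeless le_active)
    (transport_refl dKB)) => x; last by lia.
  apply: (@leq_trans (N * D * (D * (k * (hopeless x + active M p x)) + k * B x))).
    rewrite leq_mul2l leq_add2l leq_mul2l.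
    have := @matchedB_B x; case: (matchedB x) => [/(_ isT) ->|_].
      by rewrite leqnn !orbT.
    by rewrite leq0n !orbT.
  by rewrite /K; lia.
apply: transport_mono (transportD (transportD le_hopeless le_active)
  le_unmatchedB) => x; last by lia.
rewrite -!mulnDr leq_mul2l; apply/orP; right.
rewrite /hopeless; case: (unmatchedA x) => //=; last by rewrite leq_addl.
by case: (active M p x) => /=; lia.
Qed.

End Regular.
End Auction.
End Transport.

(** * Regular measure-preserving graphs *)

(** Turns a degree given as a cardinality of edges into a sum over the colours that name those edges
    injectively. *)
Lemma card_injective_image (J : finType) (T : Type) (P : pred J) (phi : J -> T)
    (X : set T) k :
  (forall c c', P c -> P c' -> phi c = phi c' -> c = c') ->
  X = [set phi c | c in [set c | P c]] -> (X #= `I_k)%card ->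
  \sum_c P c = k.
Proof.
move=> phi_inj -> Xk.
have Pk : ([set c | P c] #= `I_k)%card.
  apply: card_eq_trans Xk; rewrite card_eq_sym; apply: inj_card_eq => c c'.
  by rewrite !inE; exact: phi_inj.
have PN : ([set c | P c] #= `I_#|P|)%card.
  have -> : [set c | P c] = [set enum_val i | i in [set: 'I_#|P|]].
    apply/predeqP => c; split=> [Pc|[i _ <-]]; last exact: (enum_valP i).
    by exists (enum_rank_in Pc c) => //; rewrite enum_rankK_in.
  apply: card_eq_trans (inj_card_eq _) _; first by move=> i j _ _; exact: enum_val_inj.
  by rewrite card_eq_sym card_II.
have /card_eq_II <- : (`I_#|P| #= `I_k)%card.
  by apply: card_eq_trans Pk; rewrite card_eq_sym.
by rewrite -sum1_card [RHS]big_mkcond; apply: eq_bigr => c _; rewrite unfold_in; case: (P c).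
Qed.

Section Graph.
Context (L : fo_language) (S : fo_structure L) (n : nat).
Local Notation point := (pt S n).
Context (I : set (point -> point)) (hI : isomorphism_set I).
Context (A B : set point) (E : set (point * point)).

(** A colour is a part [P i] together with a map of [F i], which is extended to an isomorphism [g c]
    with inverse [h c]. *)
Lemma measure_preserving_coloring :
  measure_preserving I A B E ->
  exists (J : finType) (Q : J -> point -> bool) (g h : J -> point -> point),
    [/\ forall c, simple_definable (Q c),
        forall c, [/\ I (g c), I (h c), cancel (g c) (h c) & cancel (h c) (g c)],
        forall x y, E (x, y) <-> exists2 c, Q c x & y = g c x
      & forall c c' x, Q c x -> Q c' x -> g c x = g c' x -> c = c'].
Proof.
case=> [[_ _ _ _ EAB] [l [P [F [dP trivP PA FP]]]]].
have /choice[s sP] i : exists s : seq {classic point -> point}, F i = [set` s].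
  by apply/finite_seqP; have [] := FP i.
pose J := {i : 'I_l & seq_sub (s i)}.
have /choice[gh ghP] (c : J) : exists gh : (point -> point) * (point -> point),
    [/\ I gh.1, I gh.2, cancel gh.1 gh.2 & cancel gh.2 gh.1] /\
    forall x, P (tag c) x -> ssval (tagged c) x = gh.1 x.
  have [_ + _ _] := FP (tag c).
  move=> /(_ (ssval (tagged c)))[|_ _ _ [g Ig gE]].
    by rewrite sP /=; exact: ssvalP.
  have [h [Ih gK hK]] := isomorphism_inverse hI Ig.
  by exists (g, h); split.
exists J, (fun c x => `[< P (tag c) x >]), (fun c => (gh c).1), (fun c => (gh c).2).
split.
- move=> c; apply/simple_definable_set.
  suff -> : [set x | `[< P (tag c) x >]] = P (tag c) by exact: dP.
  by apply/predeqP => x; split=> /asboolP.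
- by move=> c; have [] := ghP c.
- move=> x y; split=> [Exy|[c /asboolP Px ->]].
    have [Ax _] := EAB _ Exy.
    have [i _ Pix] : (\bigcup_i P i) x by rewrite PA.
    have [_ _ _ EP] := FP i.
    have : (E `&` (P i `*` setT)) (x, y) by [].
    rewrite EP => -[f]; rewrite sP /= => fs [/= _ yE].
    exists (Tagged (fun i => seq_sub (s i)) (SeqSub fs)); first exact/asboolP.
    by have [_ <-] := ghP (Tagged (fun i => seq_sub (s i)) (SeqSub fs)).
  have [_ <- //] := ghP c.
  have [_ _ _ EP] := FP (tag c).
  suff : (E `&` (P (tag c) `*` setT)) (x, ssval (tagged c) x) by case.
  rewrite EP; exists (ssval (tagged c)) => //.
  by rewrite sP /=; exact: ssvalP.
- move=> c c' x /asboolP Px /asboolP Px'.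
  have [_ <- //] := ghP c; have [_ <- //] := ghP c'.
  case: c c' Px Px' => [i f] [i' f'] /= Px Px' ff'.
  (* Disjointness of the parts identifies the indices; disjointness of the graphs over [P i] then
     identifies the maps. *)
  have E' : i = i' by apply: trivP => //; exists x.
  subst i'; congr existT; apply/val_inj => /=.
  have [_ _ trivF _] := FP i.
  apply: trivF; [by rewrite sP /=; exact: ssvalP..|].
  by exists (x, ssval f x); split; split.
Qed.

(** * Degrees and matchings read from the colours *)

Context (J : finType) (Q : J -> point -> bool) (g h : J -> point -> point).
Context (gK : forall c, cancel (g c) (h c)) (hK : forall c, cancel (h c) (g c)).
Context (EQ : forall x y, E (x, y) <-> exists2 c, Q c x & y = g c x).
Context (Qinj : forall c c' x, Q c x -> Q c' x -> g c x = g c' x -> c = c').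
Context (AB0 : A `&` B = set0) (EAB : E `<=` A `*` B).
Context (k : nat) (hreg : k_regular k A B E).

Lemma disjoint_bipartition x : A x -> B x -> False.
Proof. by move=> Ax Bx; have : (A `&` B) x by []; rewrite AB0. Qed.

Lemma color_edge c x : Q c x -> A x /\ B (g c x).
Proof. by move=> Qx; apply: (EAB (t := (x, g c x))); apply/EQ; exists c. Qed.

(** The colours defined at [x] name its edges without repetition; no edge has [x] as right end,
    because [A] and [B] are disjoint. *)
Lemma left_degree x : A x -> \sum_c Q c x = k.
Proof.
move=> Ax; have := hreg (v := x) (or_introl Ax).
apply: (card_injective_image (phi := fun c => (x, g c x))).
  by move=> c c' Qc Qc' [] /(Qinj Qc Qc').
apply/predeqP => -[a b]; split=> [[Eab [/= ax|/= bx]]|[c /= Qc [<- <-]]].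
- by subst a; have /EQ[c Qc ->] := Eab; exists c.
- by subst b; have [_ /disjoint_bipartition] := EAB Eab; case/(_ Ax).
- by split; [apply/EQ; exists c | left].
Qed.

Lemma right_degree y : B y -> \sum_c Q c (h c y) = k.
Proof.
move=> By; have := hreg (v := y) (or_intror By).
apply: (card_injective_image (phi := fun c => (h c y, y))).
  move=> c c' Qc Qc' [] hh; apply: (Qinj Qc); first by rewrite hh.
  by rewrite hK hh hK.
apply/predeqP => -[a b]; split=> [[Eab [/= ay|/= bY]]|[c /= Qc [<- <-]]].
- by subst a; have [/disjoint_bipartition] := EAB Eab; case/(_ By).
- by subst b; have /EQ[c Qc yE] := Eab; exists c; rewrite /= yE gK.
- by split; [apply/EQ; exists c; rewrite ?hK | right].
Qed.

Definition colored_edges (M : J -> point -> bool) : set (point * point) :=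
  [set e | exists2 c, M c e.1 & e.2 = g c e.1].

(** By disjointness of [A] and [B], a common vertex lies on the same side of both edges, where only
    one colour of [M] is available. *)
Lemma colored_edges_matching (M : J -> point -> bool) :
  (forall c x, M c x -> Q c x) ->
  (forall x, \sum_c M c x <= 1) -> (forall y, \sum_c M c (h c y) <= 1) ->
  matching E (colored_edges M).
Proof.
move=> MQ Ml Mr; have ME : colored_edges M `<=` E.
  by move=> [x y] [c /= /MQ Qc ->]; apply/EQ; exists c.
split=> // -[x y] [x' y'] v Me Me' ve ve'.
have [Ax By] := EAB (ME _ Me); have [Ax' By'] := EAB (ME _ Me').
case: Me Me' => /= c Mc yE [/= c' Mc' yE'].
case: ve ve' => /= vE [] /= vE'; rewrite /= in Ax By Ax' By'.
- subst x x'; by rewrite yE yE' (sum_bool_le1_inj (Ml v) Mc Mc').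
- by case: (@disjoint_bipartition v); rewrite -?vE // vE -vE'.
- by case: (@disjoint_bipartition v); rewrite -?vE' // vE' -vE.
- have xE : x = h c v by rewrite -vE yE gK.
  have xE' : x' = h c' v by rewrite -vE' yE' gK.
  rewrite xE in Mc; rewrite xE' in Mc'.
  by rewrite vE vE' xE xE' (sum_bool_le1_inj (P := fun c => M c (h c v)) (Mr v) Mc Mc').
Qed.

Lemma covered_colored_left (M : J -> point -> bool) c x : M c x -> covered (colored_edges M) x.
Proof. by exists (x, g c x); [exists c | left]. Qed.

Lemma covered_colored_right (M : J -> point -> bool) c y :
  M c (h c y) -> covered (colored_edges M) y.
Proof. by exists (h c y, y); [exists c; rewrite /= ?hK | right]. Qed.

Lemma colored_edges_definable (M : J -> point -> bool) :
  (forall c, I (g c)) -> (forall c, simple_definable (M c)) ->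
  definable_rel (colored_edges M).
Proof.
move=> Ig dM; apply/definable_relP.
have dc c : expressible (fun e : 'I_n + 'I_n -> S =>
    M c (e \o inl) /\ e \o inr = g c (e \o inl)).
  have /simple_definable_set/definable_expressible dMc := dM c.
  have /definable_relP dg := isomorphism_definable hI (Ig c).
  apply: expressible_iff (expressible_and (expressible_rename inl dMc) dg) _ => e.
  by split=> [[? []]|[]].
apply: expressible_iff (expressible_exists_fin dc) _ => e.
by split=> -[c]; [case; exists c | exists c].
Qed.

End Graph.

Theorem theorem4p5 (L : fo_language) (S : fo_structure L) (n : nat)
    (I : set (pt S n -> pt S n)) (hI : isomorphism_set I)
    (A B : set (pt S n)) (E : set (pt S n * pt S n))
    (k : nat) (hk : (2 <= k)%N)
    (hG : measure_preserving I A B E) (hreg : k_regular k A B E)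
    (m : nat) (hm : (0 < m)%N) :
  exists (M : set (pt S n * pt S n)) (Y0 : set (pt S n)),
    [/\ definable_rel M /\ matching E M,
        definable Y0 /\ Y0 `<=` A `|` B,
        (A `|` B) `\` Y0 `<=` covered M
      & le_m I (m%:R)%R Y0 (A `|` B)].
Proof.
have [[dA dB _ AB0 EAB] _] := hG.
have [J [Q [g [h [dQ iso EQ Qinj]]]]] := measure_preserving_coloring hI hG.
have Ig c : I (g c) by have [] := iso c.
have Ih c : I (h c) by have [] := iso c.
have gK c : cancel (g c) (h c) by have [] := iso c.
have hK c : cancel (h c) (g c) by have [] := iso c.
pose a x := `[< A x >]; pose b x := `[< B x >].
have aE : [set x | a x] = A by apply/predeqP => x; split=> /asboolP.
have bE : [set x | b x] = B by apply/predeqP => x; split=> /asboolP.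
have da : simple_definable a by apply/simple_definable_set; rewrite aE.
have db : simple_definable b by apply/simple_definable_set; rewrite bE.
have Qa c x : Q c x -> a x by move=> /(color_edge EQ EAB)[? _]; apply/asboolP.
have Qb c x : Q c x -> b (g c x) by move=> /(color_edge EQ EAB)[_ ?]; apply/asboolP.
have dega x : a x -> \sum_c Q c x = k.
  by move=> /asboolP; exact: (left_degree EQ Qinj AB0 EAB hreg).
have degb y : b y -> \sum_c Q c (h c y) = k.
  by move=> /asboolP; exact: (right_degree gK hK EQ Qinj AB0 EAB hreg).
(* Without colours all degrees vanish, so [k >= 2] leaves no vertices. The case is separate because
   [I] may then lack the identity. *)
have [c0 _|J0] := pickP (fun _ : J => true); last first.
  have AB x : (A `|` B) x -> False.
    move=> ABx; suff : 0 = k by move: hk => /[swap] <-.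
    case: ABx => /asboolP; [move=> /dega <- | move=> /degb <-];
      by rewrite big1 // => c; have := J0 c.
  have c00 : [set x : pt S n | false] = set0 by apply/predeqP.
  exists (colored_edges g (fun _ _ => false)), set0; split.
  - split.
      apply: (colored_edges_definable hI Ig) => c.
      exact: simple_definable_cst.
    by apply: (colored_edges_matching gK EQ AB0 EAB) => // x; rewrite big1.
  - by split=> //; rewrite -c00; exact/simple_definable_set/simple_definable_cst.
  - by move=> x [/AB].
  exists m, 1; split => //; first by rewrite GRing.divr1.
  exists 0, (fun=> set0), (fun i : 'I_0 => match notF (ltn_ord i) with end),
    (fun i : 'I_0 => match notF (ltn_ord i) with end), (fun=> id); split.
  - by case.
  - by case.
  - by apply/predeqP => -[i x]; split=> [[[]]|].
  - by case.
  - by case.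
(* The definition of [isomorphism_set] allows an empty [I]; a colour composed with its inverse
   provides the identity. *)
have hid : I id.
  have [_ Icomp _] := hI; suff -> : id = h c0 \o g c0 by exact: Icomp.
  by apply: funext => x; rewrite /= gK.
(* The ratio reached at the end is [D / 7], so this [D] makes it exactly [m]. *)
pose D := 7 * m; pose K := k * #|J|.+1 * D.
have D0 : 0 < D by rewrite muln_gt0.
have K0 : 0 < K by rewrite muln_gt0 D0 andbT muln_gt0 (ltnW hk).
have [M [p st]] := auction_run hI hid dQ Ig Ih gK hK D (D * D * #|J|.+1).
pose y0 x := unmatchedA a M x || unmatchedB h b M x.
have dy0 : simple_definable y0.
  exact: (simple_definable_comp2 orb (unmatchedA_definable da st)
    (unmatchedB_definable hI Ih db st)).
have y0AB : [set x | y0 x] `<=` A `|` B.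
  by move=> x /= /orP[/andP[/asboolP]|/andP[/asboolP]]; [left|right].
exists (colored_edges g M), [set x | y0 x]; split.
- split; first exact (colored_edges_definable hI Ig (holding_definable st)).
  exact: (colored_edges_matching gK EQ AB0 EAB (holding_edge st)
    (holding_left st) (holding_right st)).
- by split=> //; apply/simple_definable_set.
- move=> x [ABx /= /negP]; rewrite negb_or => /andP[nA nB].
  case: ABx => [/asboolP ax|/asboolP bx].
    move: nA; rewrite /unmatchedA /a ax negbK => /existsP[c].
    exact: covered_colored_left.
  move: nB; rewrite /unmatchedB /b bx negbK => /existsP[c].
  exact: covered_colored_right.
exists (D * K), (7 * K); split; [by rewrite muln_gt0 D0|by rewrite muln_gt0|..].
  have -> : D * K = m * (7 * K) by rewrite /D; lia.
  by rewrite GRing.natrM GRing.mulfK // Num.Theory.pnatr_eq0 muln_eq0 -lt0n.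
have -> : A `|` B = [set x | a x || b x].
  by apply/predeqP => x; rewrite -{1}aE -{1}bE /=; split=> /orP.
apply: (transport_copies_le hI hid) => //.
(* The bound uses copies of [B] alone, which lies in the union. *)
apply: transport_mono (unmatched_transport hI hid dQ Ig Ih gK hK da db Qa Qb
  dega degb st D0 erefl) => x //.
by rewrite leq_mul2l; case: (b x); rewrite ?orbT.
Qed.
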